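(* Let $f:\mathbb{R}\to\mathbb{R}$ be a strictly convex function such that $f(x)\ge 0$ for all $x\in\mathbb{R}$, $f(0)=0$, and $f(x)=f(-x)$ for all $x\in\mathbb{R}$. Let $A=\begin{pmatrix}1&0\\ 0&-1\end{pmatrix}$. Then for all real numbers $u_j^n,u_{j+1}^n$, the Godunov flux $\hat f_{j+\frac12}$ associated with $(u_j^n,u_{j+1}^n)$ is the output of the composition $$ \begin{pmatrix} u_j^n \\ {u_{j+1}^n} \end{pmatrix}\xrightarrow{\;A\cdot\;}\mathbb{R}^2\xrightarrow{\;\mathrm{ReLU}\;}\mathbb{R}^2\xrightarrow{\;f\;}\mathbb{R}^2\xrightarrow{\;\max\;}\mathbb{R}, $$ where $\mathrm{ReLU}$ and $f$ act componentwise and $\max$ takes the larger of the two components; that is, $$ \hat f_{j+\frac12}=\max\left\{f\left(\mathrm{ReLU}(u_j^n)\right),\;f\left(\mathrm{ReLU}(-u_{j+1}^n)\right)\right\}. $$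
   Context: $\mathrm{ReLU}(x)=\max\{x,0\}$ for $x\in\mathbb{R}$. For $f:\mathbb{R}\to\mathbb{R}$ and real numbers $u_j^n,u_{j+1}^n$, the Godunov flux is $$ \hat f_{j+\frac12}=\begin{cases}\max\limits_{u\in[u^n_{j+1},u^n_j]} f(u) & \text{if } u^n_{j+1}\le u^n_j,\\[4pt] \min\limits_{u\in[u^n_j,u^n_{j+1}]} f(u) & \text{if } u^n_j\le u^n_{j+1}.\end{cases} $$ *)

(* Defs.v *)
From HB Require Import structures.
From mathcomp Require Import all_boot all_order all_algebra.
From mathcomp Require Import boolp classical_sets set_interval reals.

Set Implicit Arguments.
Unset Strict Implicit.
Unset Printing Implicit Defensive.

Import Order.TTheory GRing.Theory Num.Theory.
Local Open Scope classical_set_scope.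
Local Open Scope ring_scope.

Definition strictly_convex (R : realType) (f : R -> R) : Prop :=
  forall x y t : R, x != y -> 0 < t -> t < 1 ->
    f (t * x + (1 - t) * y) < t * f x + (1 - t) * f y.

(* Attained extrema, as opposed to [sup S] and [inf S]. *)
Definition is_maximum (R : realType) (S : set R) (m : R) : Prop :=
  S m /\ ubound S m.

Definition is_minimum (R : realType) (S : set R) (m : R) : Prop :=
  S m /\ lbound S m.

(* [is_godunov_flux f uj uj1 v] : the Godunov flux at the interface between
   the left state [uj] and the right state [uj1] is [v].  It is a relation
   because the maximum and minimum of an arbitrary [f] need not exist.  Both
   clauses apply when [uj = uj1]; each then says [v = f uj]. *)
Definition is_godunov_flux (R : realType) (f : R -> R) (uj uj1 v : R) : Prop :=
  (uj1 <= uj -> is_maximum (f @` `[uj1, uj]) v) /\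
  (uj <= uj1 -> is_minimum (f @` `[uj, uj1]) v).

Definition ReLU (R : realType) (x : R) : R := Num.max x 0.

Definition col2 (R : realType) (a b : R) : 'cV[R]_2 :=
  \col_(i < 2) [:: a; b]`_i.

Definition matA (R : realType) : 'M[R]_2 :=
  \matrix_(i < 2, j < 2) (nth [::] [:: [:: 1; 0]; [:: 0; -1]] i)`_j.

Definition max2 (R : realType) (x : 'cV[R]_2) : R :=
  Num.max (x ord0 ord0) (x ord_max ord0).

Definition godunov_network (R : realType) (f : R -> R) (x : 'cV[R]_2) : R :=
  max2 (map_mx f (map_mx (@ReLU R) (matA R *m x))).

(* Main.v *)
Require Import Defs.
From HB Require Import structures.
From mathcomp Require Import all_boot all_order all_algebra.
From mathcomp Require Import boolp classical_sets set_interval reals.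

Set Implicit Arguments.
Unset Strict Implicit.
Unset Printing Implicit Defensive.

Import Order.TTheory GRing.Theory Num.Theory.
Local Open Scope classical_set_scope.
Local Open Scope ring_scope.

(** Convexity and [f 0 = 0 <= f] make [f] nondecreasing on the nonnegative
    reals ([strictly_convex_le]), and evenness mirrors this on the negative side:
    the graph of [f] is a valley with its bottom at [0].  So [f] is the larger
    of two monotone branches: [f (ReLU u)], which is nondecreasing in [u], and
    [f (ReLU (- u))], which is nonincreasing; at each [u] one of the branches
    vanishes and the other is [f u] ([branch_decomposition]).  Write [v]
    for [max (f (ReLU uj)) (f (ReLU (- uj1)))].

    If [uj1 <= uj], the nondecreasing branch is largest at [uj] and the
    nonincreasing one at [uj1], so [v] bounds [f] on [[uj1, uj]]; of the four
    branch values at the two endpoints these two dominate, so [v] is also the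
    larger of [f uj1] and [f uj], and is attained ([is_maximum_branches]).

    If [uj <= uj1], the branches are smallest at [uj] and [uj1] respectively, so
    [v] is a lower bound of [f] on [[uj, uj1]]; it is attained at the point of
    the interval closest to [0] ([is_minimum_branches]).

    Attained extrema are unique, so the Godunov flux can only be [v]. *)

Lemma is_maximum_unique (R : realType) (S : set R) (a b : R) :
  is_maximum S a -> is_maximum S b -> a = b.
Proof.
move=> [Sa ua] [Sb ub]; apply/eqP; rewrite eq_le.
by apply/andP; split; [exact: ub | exact: ua].
Qed.

Lemma is_minimum_unique (R : realType) (S : set R) (a b : R) :
  is_minimum S a -> is_minimum S b -> a = b.
Proof.
move=> [Sa la] [Sb lb]; apply/eqP; rewrite eq_le.
by apply/andP; split; [exact: la | exact: lb].
Qed.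

Lemma is_godunov_flux_unique (R : realType) (f : R -> R) (uj uj1 v w : R) :
  is_godunov_flux f uj uj1 v -> is_godunov_flux f uj uj1 w -> v = w.
Proof.
move=> [maxv minv] [maxw minw]; case/orP: (le_total uj1 uj) => le_u.
  exact: is_maximum_unique (maxv le_u) (maxw le_u).
exact: is_minimum_unique (minv le_u) (minw le_u).
Qed.

Lemma ReLU_ge0 (R : realType) (x : R) : 0 <= ReLU x.
Proof. by rewrite /ReLU le_max lexx orbT. Qed.

Lemma ReLU_id (R : realType) (x : R) : 0 <= x -> ReLU x = x.
Proof. by move=> x_ge0; rewrite /ReLU max_l. Qed.

Lemma ReLU_eq0 (R : realType) (x : R) : x <= 0 -> ReLU x = 0.
Proof. by move=> x_le0; rewrite /ReLU max_r. Qed.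

Lemma le_ReLU (R : realType) (x y : R) : x <= y -> ReLU x <= ReLU y.
Proof. by move=> le_xy; rewrite /ReLU ge_max !le_max le_xy lexx orbT. Qed.

Lemma godunov_networkE (R : realType) (f : R -> R) (a b : R) :
  godunov_network f (col2 a b) = Num.max (f (ReLU a)) (f (ReLU (- b))).
Proof.
rewrite /godunov_network /max2 !mxE !big_ord_recl !big_ord0 !mxE /=.
by rewrite !mul1r !mul0r !mulN1r !addr0 add0r.
Qed.

(** A point [x] of [[0, y]] is the convex combination of [y] and [0] with weight
    [x / y] on [y], so convexity gives [f x <= (x / y) * f y <= f y]. *)
Lemma strictly_convex_le (R : realType) (f : R -> R) (x y : R) :
  strictly_convex f -> (forall z, 0 <= f z) -> f 0 = 0 ->
  0 <= x -> x <= y -> f x <= f y.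
Proof.
move=> f_conv f_ge0 f0.
rewrite le_eqVlt => /predU1P[<- _|x_gt0]; first by rewrite f0.
rewrite le_eqVlt => /predU1P[->//|lt_xy].
have y_gt0 := lt_trans x_gt0 lt_xy.
have t_gt0 : 0 < x / y by rewrite divr_gt0.
have t_lt1 : x / y < 1 by rewrite ltr_pdivrMr ?mul1r.
have := f_conv y 0 (x / y) (lt0r_neq0 y_gt0) t_gt0 t_lt1.
rewrite f0 !mulr0 !addr0 divfK ?lt0r_neq0// => /ltW /le_trans; apply.
by rewrite ler_piMl// ltW.
Qed.

Section Branches.
Variables (R : realType) (f : R -> R).
Hypotheses (f_ge0 : forall x, 0 <= f x) (f0 : f 0 = 0).
Hypothesis f_even : forall x, f x = f (- x).
Hypothesis f_le : forall x y, 0 <= x -> x <= y -> f x <= f y.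

Lemma branch_decomposition (u : R) :
  f u = Num.max (f (ReLU u)) (f (ReLU (- u))).
Proof.
case/orP: (le_total 0 u) => u0.
  by rewrite (ReLU_id u0) ReLU_eq0 ?oppr_le0// f0 max_l.
by rewrite (ReLU_eq0 u0) ReLU_id ?oppr_ge0// f0 max_r// -f_even.
Qed.

Lemma right_branch_le (a b : R) : a <= b -> f (ReLU a) <= f (ReLU b).
Proof. by move=> le_ab; rewrite f_le ?ReLU_ge0 ?le_ReLU. Qed.

Lemma left_branch_le (a b : R) : a <= b -> f (ReLU (- b)) <= f (ReLU (- a)).
Proof. by move=> le_ab; rewrite right_branch_le ?lerN2. Qed.

Lemma is_maximum_branches (a b : R) : a <= b ->
  is_maximum (f @` `[a, b]) (Num.max (f (ReLU b)) (f (ReLU (- a)))).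
Proof.
move=> le_ab; set v := Num.max _ _.
have v_ub u : a <= u <= b -> f u <= v.
  case/andP=> le_au le_ub; rewrite branch_decomposition ge_max /v !le_max.
  by rewrite right_branch_le// left_branch_le// orbT.
have fa_le : f a <= v by rewrite v_ub// lexx.
have fb_le : f b <= v by rewrite v_ub// le_ab lexx.
split; last by move=> _ [u /= u_ab <-]; apply: v_ub; rewrite in_itv in u_ab.
(* [v] is the nondecreasing branch at [b] or the nonincreasing one at [a], and
   [f] dominates both of its branches. *)
have [v_le|v_le] : v <= f b \/ v <= f a.
  have gb : f (ReLU b) <= f b by rewrite [leRHS]branch_decomposition le_max lexx.
  have ga : f (ReLU (- a)) <= f a.
    by rewrite [leRHS]branch_decomposition le_max lexx orbT.
  by rewrite /v; case: (leP (f (ReLU b)) (f (ReLU (- a)))); [right | left].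
- by exists b; [rewrite /= in_itv /= le_ab lexx | apply: le_anti; rewrite fb_le].
- by exists a; [rewrite /= in_itv /= lexx le_ab | apply: le_anti; rewrite fa_le].
Qed.

Lemma is_minimum_branches (a b : R) : a <= b ->
  is_minimum (f @` `[a, b]) (Num.max (f (ReLU a)) (f (ReLU (- b)))).
Proof.
move=> le_ab; split; last first.
  move=> _ [u /= + <-]; rewrite in_itv /= => /andP[le_au le_ub].
  rewrite [leRHS]branch_decomposition ge_max !le_max.
  by rewrite right_branch_le// left_branch_le// orbT.
case/orP: (le_total 0 a) => a0.
  exists a; first by rewrite /= in_itv /= lexx.
  rewrite ReLU_id// (@ReLU_eq0 _ (- b)) ?oppr_le0 ?(le_trans a0)//.
  by rewrite f0 max_l.
case/orP: (le_total 0 b) => b0.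
  exists 0; first by rewrite /= in_itv /= a0.
  by rewrite !ReLU_eq0 ?oppr_le0// maxxx.
exists b; first by rewrite /= in_itv /= lexx le_ab.
by rewrite (ReLU_eq0 a0) ReLU_id ?oppr_ge0// f0 max_r// -f_even.
Qed.

End Branches.

Theorem proposition2 (R : realType) (f : R -> R)
    (f_strictly_convex : strictly_convex f)
    (f_ge0 : forall x : R, 0 <= f x)
    (f0 : f 0 = 0)
    (f_even : forall x : R, f x = f (- x))
    (uj uj1 : R) :
  (forall fhat : R,
     is_godunov_flux f uj uj1 fhat <-> fhat = godunov_network f (col2 uj uj1)) /\
  godunov_network f (col2 uj uj1) = Num.max (f (ReLU uj)) (f (ReLU (- uj1))).
Proof.
have f_le x y : 0 <= x -> x <= y -> f x <= f y by exact: strictly_convex_le.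
rewrite godunov_networkE; split=> // fhat; set v := Num.max _ _.
have v_flux : is_godunov_flux f uj uj1 v.
  by split=> le_u; [exact: is_maximum_branches | exact: is_minimum_branches].
by split=> [fhat_flux|->//]; exact: is_godunov_flux_unique fhat_flux v_flux.
Qed.
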